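(* Let $\mathbf G=(V,\mathcal E,\rho)$ be a pointed finite connected graph. Consider the graph $G^\circ$ whose vertex set is $V^\circ=\mathrm{Cac}(\mathbf G)$ and whose edges are all pairs $\{a,b\}$ such that $d^{\mathbf G}_{\mathrm{Cac}}(a,b)=1$. Then $G^\circ$ is a tree, and the graph distance $d_{gr}^{G^\circ}$ on $V^\circ$ coincides with the cactus distance $d^{\mathbf G}_{\mathrm{Cac}}$ on $\mathrm{Cac}(\mathbf G)$.
   Context: $V$ is a finite set, $\mathcal E$ is a set of unordered pairs of distinct elements of $V$, the graph $G=(V,\mathcal E)$ is connected and $\rho\in V$. Let $d_{gr}^G$ be the graph distance. For $v,v'\in V$ set $$d^{\mathbf G}_{\mathrm{Cac}}(v,v')=d_{gr}^G(\rho,v)+d_{gr}^G(\rho,v')-2\max_{\gamma:v\to v'}\min_{a\in\gamma}d_{gr}^G(\rho,a),$$ the maximum being over all paths $\gamma$ from $v$ to $v'$ in $G$. This is a pseudo-distance on $V$; $\mathrm{Cac}(\mathbf G)$ is the quotient of $V$ by the relation $d^{\mathbf G}_{\mathrm{Cac}}(v,v')=0$, equipped with the induced distance, still denoted by $d^{\mathbf G}_{\mathrm{Cac}}$. *)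

(* Defs.v *)
From HB Require Import structures.
From mathcomp Require Import all_boot all_order all_algebra.
From mathcomp Require Import boolp zify.

Set Implicit Arguments.
Unset Strict Implicit.
Unset Printing Implicit Defensive.

Import Order.TTheory GRing.Theory Num.Theory.
Local Open Scope quotient_scope.

Record graph := Graph {
  vertex :> finType;
  adj : rel vertex;
  adj_sym : symmetric adj;
  adj_irr : irreflexive adj }.

Arguments adj {g} : rename.

Section Graphs.
Variable G : graph.
Implicit Types (x y : G) (p c : seq G).

(* The path v0, v1, ..., vn from x to y is encoded, as in [path], by its first
   vertex x = v0 and by p = [:: v1; ...; vn], so that [size p] is its number of
   edges. Vertices may be repeated. *)
Definition walk x y p := path adj x p && (last x p == y).

Definition connected := forall x y, exists p, walk x y p.

(* [size c <= 2] discards the closed sequences [:: x; y] that go back and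
   forth along one edge. *)
Definition acyclic := forall c, ucycle adj c -> size c <= 2.

Definition is_tree := [/\ 0 < #|G|, connected & acyclic].

Lemma gdist_subproof x y :
  exists n, `[< (exists p, walk x y p) ->
                exists2 p, walk x y p & size p = n >].
Proof.
have [[p wp]|nw] := pselect (exists p, walk x y p).
- by exists (size p); apply/asboolP => _; exists p.
- by exists 0; apply/asboolP => /nw.
Qed.

(* The graph distance; it is 0 by convention when no path joins x to y. *)
Definition gdist x y : nat := ex_minn (gdist_subproof x y).

Lemma gdistP x y : (exists p, walk x y p) ->
  (exists2 p, walk x y p & size p = gdist x y) /\
  (forall p, walk x y p -> gdist x y <= size p).
Proof.
move=> exw; rewrite /gdist; case: ex_minnP => n /asboolP/(_ exw) wn minn.
by split=> // p wp; apply: minn; apply/asboolP => _; exists p.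
Qed.

End Graphs.

Record pointed_graph := PointedGraph {
  base :> graph;
  basepoint : base;
  base_connected : connected base }.

Arguments basepoint {p} : rename.

Section Cactus.
Variable G : pointed_graph.
Implicit Types (u v w : G) (p : seq G).

Definition height v : nat := gdist basepoint v.

(* For p a walk starting at v, the minimum over its vertices, v included. *)
Definition min_height v p : nat := \big[minn/height v]_(a <- p) height a.

Lemma min_height_le v p : min_height v p <= height v.
Proof.
rewrite /min_height; elim: p => [|a p IH]; first by rewrite big_nil.
by rewrite big_cons geq_min IH orbT.
Qed.

Lemma min_heightP v p m :
  (m <= min_height v p) = all (fun a => m <= height a) (v :: p).
Proof.
rewrite /min_height; elim: p => [|a p IH]; first by rewrite big_nil /= andbT.
by rewrite big_cons leq_min IH /= andbCA.
Qed.

Lemma maxmin_subproof1 v w :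
  exists m, `[< exists2 p, walk v w p & min_height v p = m >].
Proof.
have [p wp] := base_connected v w.
by exists (min_height v p); apply/asboolP; exists p.
Qed.

Lemma maxmin_subproof2 v w m :
  `[< exists2 p, walk v w p & min_height v p = m >] -> m <= height v.
Proof. by move=> /asboolP[p _ <-]; apply: min_height_le. Qed.

Definition maxmin_height v w : nat :=
  ex_maxn (maxmin_subproof1 v w) (@maxmin_subproof2 v w).

Lemma maxmin_heightP v w :
  (exists2 p, walk v w p & min_height v p = maxmin_height v w) /\
  (forall p, walk v w p -> min_height v p <= maxmin_height v w).
Proof.
rewrite /maxmin_height; case: ex_maxnP => m /asboolP wm maxm.
by split=> // p wp; apply: maxm; apply/asboolP; exists p.
Qed.

Definition cac_pdist v w : int :=
  ((height v)%:Z + (height w)%:Z - 2 * (maxmin_height v w)%:Z)%R.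

Lemma maxmin_height_le v w :
  (maxmin_height v w <= height v) && (maxmin_height v w <= height w).
Proof.
have [[p /andP[_ /eqP lp] mp] _] := maxmin_heightP v w.
have /allP hp : all (fun a => maxmin_height v w <= height a) (v :: p).
  by rewrite -min_heightP mp.
by rewrite hp ?mem_head ?hp // -[w in w \in _]lp mem_last.
Qed.

Lemma maxmin_height_refl v : maxmin_height v v = height v.
Proof.
apply/eqP; rewrite eqn_leq; have /andP[-> _] := maxmin_height_le v v.
have [_ /(_ [::])] := maxmin_heightP v v.
by rewrite /walk /= eqxx /min_height big_nil; apply.
Qed.

Lemma maxmin_height_sym_le v w : maxmin_height v w <= maxmin_height w v.
Proof.
have [[p /andP[pp /eqP lp] mp] _] := maxmin_heightP v w.
have [_ H] := maxmin_heightP w v.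
apply: leq_trans (H (rev (belast v p)) _); last first.
  rewrite /walk -{1}lp rev_path (eq_path (e' := adj)) ?pp /=; last first.
    by move=> a b; rewrite adj_sym.
  by case: p {pp mp} lp => [|a p] /= lp; rewrite ?lp // rev_cons last_rcons.
have /allP hp : all (fun a => maxmin_height v w <= height a) (v :: p).
  by rewrite -min_heightP mp.
rewrite min_heightP; apply/allP => a ain; apply: hp.
rewrite lastI lp mem_rcons.
by move: ain; rewrite !inE mem_rev.
Qed.

Lemma maxmin_height_sym v w : maxmin_height v w = maxmin_height w v.
Proof. by apply/eqP; rewrite eqn_leq !maxmin_height_sym_le. Qed.

Lemma maxmin_height_trans u v w :
  minn (maxmin_height u v) (maxmin_height v w) <= maxmin_height u w.
Proof.
have [[p /andP[pp /eqP lp] mp] _] := maxmin_heightP u v.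
have [[q /andP[pq /eqP lq] mq] _] := maxmin_heightP v w.
have [_ H] := maxmin_heightP u w.
apply: leq_trans (H (p ++ q) _); last first.
  by rewrite /walk cat_path last_cat lp pp pq lq eqxx.
rewrite min_heightP -cat_cons all_cat -min_heightP mp geq_minl /=.
have : minn (maxmin_height u v) (maxmin_height v w) <= min_height v q.
  by rewrite mq geq_minr.
by rewrite min_heightP /= => /andP[].
Qed.

Lemma cac_pdist_ge0 v w : (0 <= cac_pdist v w)%R.
Proof. by have := maxmin_height_le v w; rewrite /cac_pdist; lia. Qed.

Lemma cac_pdist_refl v : cac_pdist v v = 0%R.
Proof. by rewrite /cac_pdist maxmin_height_refl; lia. Qed.

Lemma cac_pdist_sym v w : cac_pdist v w = cac_pdist w v.
Proof. by rewrite /cac_pdist maxmin_height_sym; lia. Qed.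

Lemma cac_pdist_triangle u v w :
  (cac_pdist u w <= cac_pdist u v + cac_pdist v w)%R.
Proof.
have := maxmin_height_trans u v w.
have := maxmin_height_le u v; have := maxmin_height_le v w.
by rewrite /cac_pdist; lia.
Qed.

Definition cac_eq : rel G := fun v w => cac_pdist v w == 0%R.

Lemma cac_eq_refl : reflexive cac_eq.
Proof. by move=> v; rewrite /cac_eq cac_pdist_refl. Qed.

Lemma cac_eq_sym : symmetric cac_eq.
Proof. by move=> v w; rewrite /cac_eq cac_pdist_sym. Qed.

Lemma cac_eq_trans : transitive cac_eq.
Proof.
move=> v u w /eqP uv /eqP vw; apply/eqP.
have := cac_pdist_triangle u v w; have := cac_pdist_ge0 u w.
by rewrite uv vw; lia.
Qed.

Canonical cac_equiv := EquivRel cac_eq cac_eq_refl cac_eq_sym cac_eq_trans.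

Definition cac := {eq_quot cac_equiv}.

HB.instance Definition _ := EqQuotient.on cac.
HB.instance Definition _ := Countable.on cac.

Lemma cac_enumP : Finite.axiom (undup [seq \pi_cac v | v <- enum G]).
Proof.
move=> a; rewrite count_uniq_mem ?undup_uniq // mem_undup -[a]reprK map_f //.
exact: mem_enum.
Qed.

HB.instance Definition _ := isFinite.Build cac cac_enumP.

Definition cac_dist (a b : cac) : int := cac_pdist (repr a) (repr b).

Lemma cac_dist_pi v w : cac_dist (\pi_cac v) (\pi_cac w) = cac_pdist v w.
Proof.
have piE u : cac_pdist u (repr (\pi_cac u)) = 0%R.
  by apply/eqP; rewrite -[_ == _]/(cac_equiv _ _) -eqmodE reprK.
have hv := piE v; have hw := piE w.
rewrite /cac_dist; set v' := repr (\pi_cac v) in hv *.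
set w' := repr (\pi_cac w) in hw *.
have := cac_pdist_triangle v' v w'; have := cac_pdist_triangle v w w'.
have := cac_pdist_triangle v v' w; have := cac_pdist_triangle v' w' w.
by rewrite (cac_pdist_sym v' v) (cac_pdist_sym w' w) hv hw; lia.
Qed.

Definition cac_adj : rel cac := fun a b => cac_dist a b == 1%R.

Lemma cac_adj_sym : symmetric cac_adj.
Proof. by move=> a b; rewrite /cac_adj /cac_dist cac_pdist_sym. Qed.

Lemma cac_adj_irr : irreflexive cac_adj.
Proof. by move=> a; rewrite /cac_adj /cac_dist cac_pdist_refl. Qed.

Definition cac_graph : graph := Graph cac_adj_sym cac_adj_irr.

End Cactus.

(* Main.v *)
(** A cactus distance 1 forces the heights to differ by 1, and every class of
    positive height has exactly one neighbour below it, its parent. A cycle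
    would contain a vertex of maximal height, whose two neighbours on the cycle
    would both be its parent; so the graph is acyclic. Whichever of [v] and [w]
    lies strictly above their maxmin height can be replaced by its parent,
    lowering the cactus distance by 1, which produces a walk whose length is
    the cactus distance. *)

Require Import Defs.
From mathcomp Require Import all_boot all_order all_algebra.
From mathcomp Require Import zify.

Set Implicit Arguments.
Unset Strict Implicit.
Unset Printing Implicit Defensive.

Local Open Scope quotient_scope.

Lemma acyclic_of_unique_lower_neighbor (G : graph) (f : G -> nat) :
  (forall x y z : G, adj x y -> adj x z -> f y <= f x -> f z <= f x -> y = z) ->
  acyclic G.
Proof.
move=> uniq_low [//|x0 c0] cyc; set c := x0 :: c0 in cyc *.
have x0c : x0 \in c by apply: mem_head.
case: (@arg_maxnP _ x0 (mem c) f x0c) => x xc maxx.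
have [i s rot_c] := rot_to xc.
have f_le y : y \in x :: s -> f y <= f x.
  by rewrite -rot_c mem_rot; apply: maxx.
move: cyc; rewrite /ucycle -(rot_cycle i) -(rot_uniq i) -(size_rot i c) rot_c.
(* Lengths 1 and 2 are allowed by [acyclic]. A longer cycle, rotated to start at its highest vertex
   [x], reads [x :: y :: rcons s z]; equality of the neighbours [y] and [z] contradicts uniqueness
   of its entries. *)
case: s f_le {rot_c} => [|y s] //.
case/lastP: s => [|s z] // f_le /andP[].
rewrite /= rcons_path last_rcons mem_rcons inE negb_or.
move=> /and3P[xy _ zx] /and3P[_ /andP[/negP[]]].
rewrite (uniq_low x y z) ?f_le //; first by rewrite adj_sym.
- by rewrite !inE eqxx orbT.
- by rewrite !inE mem_rcons inE eqxx !orbT.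
Qed.

Section CactusTree.
Variable G : pointed_graph.
Implicit Types (u v w : G) (a b c : cac_graph G).

Lemma height_adj v w : adj v w -> height w <= (height v).+1.
Proof.
move=> vw; have [[p /andP[pp /eqP lp] sp] _] := gdistP (base_connected basepoint v).
have [_ /(_ (rcons p w))] := gdistP (base_connected basepoint w).
by rewrite size_rcons sp; apply; rewrite /walk rcons_path last_rcons pp lp vw /=.
Qed.

(** The parent is the penultimate vertex of a shortest walk from the basepoint; the edge from it to
    [v] is a walk that never goes below it. *)
Lemma parent_exists v : 0 < height v ->
  exists2 u, height v = (height u).+1 & maxmin_height u v = height u.
Proof.
have [[p wp sp] _] := gdistP (base_connected basepoint v).
rewrite -/(height v) in sp; rewrite -sp; case/lastP: p wp sp => [//|p x] wp hv _.
move: wp; rewrite /walk rcons_path last_rcons => /andP[/andP[pp ux] /eqP xv].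
subst x; set u := last _ p in ux; rewrite size_rcons in hv *.
have hu_le : height u <= size p.
  have [_ /(_ p)] := gdistP (base_connected basepoint u).
  by apply; rewrite /walk pp eqxx.
have hv_le := height_adj ux.
have hu : height u = size p by lia.
exists u; first by rewrite hu.
have /andP[le_u _] := maxmin_height_le u v.
have [_ /(_ [:: v])] := maxmin_heightP u v.
rewrite /walk /= ux eqxx /min_height big_cons big_nil => /(_ isT).
lia.
Qed.

Lemma cac_pdist_eq0 v w : cac_pdist v w = 0%R -> \pi_(cac G) v = \pi_(cac G) w.
Proof. by move=> vw; apply/eqmodP; rewrite /= /cac_eq vw. Qed.

Lemma cac_dist_eq0 a b : cac_dist a b = 0%R -> a = b.
Proof. by move=> /cac_pdist_eq0; rewrite !reprK. Qed.

(** Distance 1 forces [b] and [c] to lie one below [a], with maxmin heights to [a] equal to their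
    own heights. Concatenating walks through [a] joins [b] to [c] without going lower, so their
    distance is 0. *)
Lemma cac_lower_neighbor_unique a b c :
  adj a b -> adj a c ->
  height (repr (b : cac G)) <= height (repr (a : cac G)) ->
  height (repr (c : cac G)) <= height (repr (a : cac G)) -> b = c.
Proof.
move=> /eqP ab /eqP ac hb hc; apply: cac_dist_eq0.
move: ab ac; rewrite /cac_dist.
set x := repr a in hb hc *; set y := repr b in hb *; set z := repr c in hc *.
have := maxmin_height_trans y x z; rewrite (maxmin_height_sym y x).
have := maxmin_height_le x y; have := maxmin_height_le x z.
have := maxmin_height_le y z.
rewrite /cac_pdist; lia.
Qed.

Lemma cac_walk_exists v w (n : nat) : cac_pdist v w = n%:Z%R ->
  exists2 p, @walk (cac_graph G) (\pi_(cac G) v) (\pi_(cac G) w) p & size p = n.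
Proof.
elim: n v w => [|n IH] v w vw.
  by exists [::] => //; rewrite /walk /= (cac_pdist_eq0 vw).
(* Passing from [x] to its parent [u] keeps the maxmin height to [y], which is at most [height u],
   and lowers the height by 1. *)
have step (x y : G) : cac_pdist x y = n.+1%:Z%R -> maxmin_height x y < height x ->
    exists2 u, cac_pdist x u = 1%R & cac_pdist u y = n%:Z%R.
  move=> xy lt_x; have [|u hx mu] := @parent_exists x; first lia.
  have xu : cac_pdist x u = 1%R by rewrite cac_pdist_sym /cac_pdist mu hx; lia.
  exists u => //; have := maxmin_height_trans u x y.
  have := maxmin_height_trans x u y; have := maxmin_height_le u y.
  by move: xy; rewrite /cac_pdist (maxmin_height_sym x u); lia.
have [lt_v|ge_v] := ltnP (maxmin_height v w) (height v).
  have [u vu uw] := step v w vw lt_v.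
  have [p wp sp] := IH u w uw.
  exists (\pi_(cac G) u :: p); last by rewrite /= sp.
  by rewrite /walk /= {1}/cac_adj cac_dist_pi vu.
(* Here [v] is at the maxmin height, so the positive distance puts [w] strictly above it; the walk
   is extended at its end. *)
have [||u wu uv] := step w v; first by rewrite cac_pdist_sym.
  rewrite maxmin_height_sym; have := maxmin_height_le v w.
  by move: vw; rewrite /cac_pdist; lia.
have [|p /andP[pp /eqP lp] sp] := IH v u; first by rewrite cac_pdist_sym.
exists (rcons p (\pi_(cac G) w)); last by rewrite size_rcons sp.
by rewrite /walk rcons_path last_rcons pp lp eqxx /=
  /cac_adj cac_dist_pi cac_pdist_sym wu.
Qed.

(** Each edge has cactus length 1, so the triangle inequality applies along the walk. *)
Lemma cac_dist_walk_le a b p : walk a b p -> (cac_dist a b <= (size p)%:Z)%R.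
Proof.
elim: p a => [|c p IH] a /andP[/=].
  by move=> _ /eqP <-; rewrite /cac_dist cac_pdist_refl.
move=> /andP[/eqP ac pp] lp.
have := IH c; rewrite /walk pp lp => /(_ isT).
have := cac_pdist_triangle (repr a) (repr c) (repr b).
by move: ac; rewrite /cac_dist /=; lia.
Qed.

Lemma cac_dist_walk_exists a b :
  exists2 p, walk a b p & (size p)%:Z%R = cac_dist a b.
Proof.
have := cac_pdist_ge0 (repr a) (repr b).
case E : (cac_pdist (repr a) (repr b)) => [n|//] _.
have [p wp sp] := cac_walk_exists E.
by exists p; [move: wp; rewrite !reprK | rewrite sp /cac_dist E].
Qed.

End CactusTree.

Theorem proposition2p2 (G : pointed_graph) :
  is_tree (cac_graph G) /\
  (forall a b : cac_graph G, (gdist a b)%:Z%R = cac_dist a b).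
Proof.
have conn : connected (cac_graph G).
  by move=> a b; have [p wp _] := cac_dist_walk_exists a b; exists p.
split=> [|a b].
  split=> //; first by apply/card_gt0P; exists (\pi_(cac G) basepoint).
  exact: acyclic_of_unique_lower_neighbor (@cac_lower_neighbor_unique G).
(* The shortest walk [p] is no shorter than the cactus distance, and no longer than the walk [q]
   that realizes it. *)
have [[p wp sp] min_len] := gdistP (conn a b).
have [q /min_len le_q sq] := cac_dist_walk_exists a b.
have := cac_dist_walk_le wp; lia.
Qed.
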